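(* For all real $\epsilon$ with $0\leq\epsilon\leq 1$, the capacity of the asymmetric two-neighbor $k$-constraint with $k=\lceil n^{\epsilon}\rceil$ satisfies $\widetilde{C}(\epsilon)=1$.
   Context: $S_n$ is the set of all permutations of $\{1,\ldots,n\}$, written $\sigma=[\sigma(1),\ldots,\sigma(n)]$. For positive integers $n,k$, a permutation $\sigma\in S_n$ satisfies the asymmetric two-neighbor $k$-constraint if for all $i$ with $2\leq i\leq n-1$, either $\sigma(i-1)-\sigma(i)\leq k$ or $\sigma(i+1)-\sigma(i)\leq k$ (inclusive or; signed differences). $B_{n,k}$ is the set of all permutations in $S_n$ satisfying this constraint. For $0\leq\epsilon\leq1$, the capacity is $\widetilde{C}(\epsilon)=\limsup_{n\to\infty}\frac{\log|B_{n,k}|}{\log n!}$, where $k=\lceil n^{\epsilon}\rceil$ and logarithms are to base 2. *)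

(* Defs.v *)
From mathcomp Require Import all_boot all_order all_algebra all_fingroup.
From mathcomp Require Import all_classical all_reals all_analysis.

Set Implicit Arguments.
Unset Strict Implicit.
Unset Printing Implicit Defensive.

Import Order.TTheory GRing.Theory Num.Theory.
Local Open Scope ring_scope.

(* Positions and values are indexed by {0, ..., n-1} instead of {1, ..., n};
   the shift is harmless as only differences of values occur.  The triples
   (h, i, j) are the (i-1, i, i+1) with i an interior position, and the
   differences are taken in int, hence signed. *)
Definition asym_two_neighbor (n k : nat) (s : 'S_n) : bool :=
  [forall h : 'I_n, forall i : 'I_n, forall j : 'I_n,
    ((h.+1 == i :> nat) && (i.+1 == j :> nat)) ==>
    (((s h)%:Z - (s i)%:Z <= k%:Z) || ((s j)%:Z - (s i)%:Z <= k%:Z))].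

Definition asym_perms (n k : nat) : {set 'S_n} :=
  [set s : 'S_n | asym_two_neighbor k s].

Definition log2 {R : realType} (x : R) : R := ln x / ln 2.

(* The absolute value only converts the ceiling, nonnegative here, to nat. *)
Definition ceil_pow {R : realType} (eps : R) (n : nat) : nat :=
  `|Num.ceil (n%:R `^ eps)|%N.

(* The limsup is taken in the extended reals, so no boundedness is presupposed.
   The terms n = 0 and n = 1, where log2 n! = 0, do not affect it. *)
Definition asym_capacity {R : realType} (eps : R) : \bar R :=
  limn_esup (fun n : nat =>
    (log2 (#|asym_perms n (ceil_pow eps n)|%:R : R) / log2 (n`!%:R : R))%:E).

(* Main.v *)
(** The upper bound is [|B_{n,k}| <= n!].  For the lower bound, write
    [n = m (q + 2)] and cut the positions into [m] blocks of length [q + 2].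
    Choose [q] permutations [f_u] of [{0, ..., m - 1}], and fill block [j] with
    the increasing sequence
    [2j, 2j + 1, 2m + f_0 j, 3m + f_1 j, ..., (q + 1) m + f_(q-1) j].
    A position that is not first in its block has a smaller left neighbor, and
    the first one has its value plus 1 on its right, so the constraint holds as
    soon as [k >= 1].  This gives [m!^q] permutations.  As [n!] is at most
    [m!^(q+3)] when [m] is large compared with [q], the ratio of logarithms is
    at least [q / (q + 3)], and [q] is arbitrary. *)

Require Import Defs.
From mathcomp Require Import all_boot all_order all_algebra all_fingroup.
From mathcomp Require Import all_classical all_reals all_analysis.
From mathcomp Require Import zify ring lra.

Set Implicit Arguments.
Unset Strict Implicit.
Unset Printing Implicit Defensive.

Import Order.TTheory GRing.Theory Num.Theory.
Local Open Scope nat_scope.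

Lemma fact_addn_leq a b : (a + b)`! <= a`! * (a + b) ^ b.
Proof.
elim: b => [|b IH]; first by rewrite addn0 expn0 muln1.
rewrite addnS factS expnS mulnCA leq_mul2l /=.
apply: leq_trans IH _; rewrite leq_mul2l; apply/orP; right.
by case: b => // b; rewrite leq_exp2r.
Qed.

Lemma expn_leq_fact_addn a b : a ^ b <= (a + b)`!.
Proof.
elim: b => [|b IH]; first by rewrite addn0 fact_gt0.
by rewrite addnS factS expnS leq_mul //; lia.
Qed.

(** Induction on [m]: passing to [m.+1] brings in [l] new factors, each at most [m.+1 * l]. *)
Lemma fact_muln_leq m l : (m * l)`! <= m`! ^ l * l ^ (m * l).
Proof.
elim: m => [|m IH]; first by rewrite !mul0n fact0 exp1n.
rewrite mulSnr; apply: leq_trans (fact_addn_leq _ _) _.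
apply: leq_trans (leq_mul IH (leqnn _)) _.
by rewrite -mulSnr factS !expnMn mulSnr expnD; apply: eq_leq; ring.
Qed.

Section LayeredPerm.
Variables (m q : nat).
Implicit Types f : {ffun 'I_q -> 'S_m.+1}.
Let n := m.+1 * q.+2.

(** The number of blocks is [m.+1], so that [inord] applies to [j]. The default 0 is never reached,
    because [t - 2 < q] once [t >= 2]. *)
Definition layered_value f (i : nat) : nat :=
  let j := i %/ q.+2 in let t := i %% q.+2 in
  if t < 2 then j * 2 + t
  else t * m.+1 + (if insub (t - 2) is Some u then f u (inord j) : nat else 0).

Lemma layered_valueE f j (u : 'I_q) :
  layered_value f (j * q.+2 + u.+2) = u.+2 * m.+1 + f u (inord j).
Proof.
have ltu := ltn_ord u.
rewrite /layered_value divnMDl // modnMDl divn_small ?modn_small ?addn0 //.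
by rewrite /= subn2 /= insubT /=; congr (_ + nat_of_ord (f _ _)); apply/val_inj.
Qed.

Lemma layered_valueE2 f j t : t < 2 ->
  layered_value f (j * q.+2 + t) = j * 2 + t.
Proof.
move=> t2; rewrite /layered_value divnMDl // modnMDl.
by rewrite divn_small ?modn_small ?addn0 ?t2 //; lia.
Qed.

(** Case analysis on this turns a position into block start plus offset, the form that
    [layered_valueE] and [layered_valueE2] rewrite. *)
Variant layer_spec : nat -> Type :=
| LayerPair j t of j < m.+1 & t < 2 : layer_spec (j * q.+2 + t)
| LayerPerm j (u : 'I_q) of j < m.+1 : layer_spec (j * q.+2 + u.+2).

Lemma layerP i : i < n -> layer_spec i.
Proof.
move=> lti; rewrite (divn_eq i q.+2).
have ltj : i %/ q.+2 < m.+1 by rewrite ltn_divLR.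
have := ltn_pmod i (isT : 0 < q.+2).
case: (i %% q.+2) => [|[|t]] ltt; try exact: LayerPair.
exact: (@LayerPerm _ (Ordinal (ltt : t < q))).
Qed.

Lemma layered_value_lt f i : i < n -> layered_value f i < n.
Proof.
move=> /layerP[j t ltj ltt|j u ltj].
  by rewrite layered_valueE2 // /n; nia.
rewrite layered_valueE /n; have := ltn_ord (f u (inord j)); have := ltn_ord u.
by nia.
Qed.

Definition layered_fun f (i : 'I_n) : 'I_n :=
  Ordinal (layered_value_lt f (ltn_ord i)).

(** Pairs take values below [2 * m.+1], and layer [u] stays in the interval of length [m.+1]
    starting at [u.+2 * m.+1]. So a value reveals its layer, and injectivity of [f u] then gives the
    block. *)
Lemma layered_fun_inj f : injective (layered_fun f).
Proof.
move=> x y /(congr1 val) /= exy; apply/val_inj => /=; move: exy.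
case: (layerP (ltn_ord x)) => [j t ltj ltt|j u ltj];
  case: (layerP (ltn_ord y)) => [j' t' ltj' ltt'|j' u' ltj'];
  rewrite ?layered_valueE ?layered_valueE2 // => e.
- have [-> ->] // : j = j' /\ t = t' by lia.
- by nia.
- by nia.
have eu : u = u'.
  apply/val_inj; move: (congr1 (fun v => v %/ m.+1) e).
  by rewrite !divnMDl // !divn_small // !addn0 => -[].
move: e; rewrite -{}eu => /addnI /val_inj /perm_inj /(congr1 val).
by move=> /=; rewrite !inordK // => ->.
Qed.

Definition layered_perm f : 'S_n := perm (@layered_fun_inj f).

Lemma layered_perm_inj : injective layered_perm.
Proof.
move=> f g efg; apply/ffunP => u; apply/permP => j; apply/val_inj.
have lti : j * q.+2 + u.+2 < n.
  by have := ltn_ord j; have := ltn_ord u; rewrite /n; nia.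
move/permP: efg => /(_ (Ordinal lti)); rewrite !permE => /(congr1 val) /=.
by rewrite !layered_valueE inord_val => /addnI.
Qed.

Lemma layered_perm_asym k f : 0 < k -> asym_two_neighbor k (layered_perm f).
Proof.
move=> k0; apply/forallP => h; apply/forallP => i; apply/forallP => j.
apply/implyP => /andP[/eqP ehi /eqP eij]; rewrite !permE /= -eij.
case: (layerP (ltn_ord i)) ehi => [a [|[|//]] lta _|a u lta] ehi.
- by rewrite -addnS !layered_valueE2 //; lia.
- have -> : h = a * q.+2 + 0 :> nat by lia.
  by rewrite !layered_valueE2 //; lia.
rewrite layered_valueE.
suff : layered_value f h <= u.+2 * m.+1 + f u (inord a) by lia.
(* The lowest layer follows the second entry of a pair, [a * 2 + 1 < 2 * m.+1]; any other follows
   the layer just below it. *)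
case: u ehi => -[|u] ltu /= ehi.
  have -> : h = a * q.+2 + 1 :> nat by lia.
  by rewrite layered_valueE2 //; nia.
have ltu' : u < q by lia.
have -> : h = a * q.+2 + (Ordinal ltu').+2 :> nat by move: ehi => /=; lia.
by rewrite layered_valueE /=; have := ltn_ord (f (Ordinal ltu') (inord a)); nia.
Qed.

Lemma card_asym_perms_geq k : 0 < k -> m.+1`! ^ q <= #|asym_perms n k|.
Proof.
move=> k0.
have -> : m.+1`! ^ q = #|[set layered_perm f | f : {ffun 'I_q -> 'S_m.+1}]|.
  by rewrite card_imset ?card_ffun ?card_ord ?card_Sn //; exact: layered_perm_inj.
apply/subset_leq_card/fintype.subsetP => _ /imsetP[f _ ->].
by rewrite inE layered_perm_asym.
Qed.

End LayeredPerm.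

(* With [r = q + 2] and [b = r ^ (2 r)], [fact_muln_leq] bounds [n!] by
   [(2b)! ^ r * r ^ (2 b r)], and the last factor is [b ^ b <= (2b)!]. *)
Lemma fact_leq_card_asym_perms q k :
  let n := (q.+2 ^ q.+2.*2).*2 * q.+2 in
  0 < k -> n`! ^ q <= #|asym_perms n k| ^ q.+3.
Proof.
move=> n k0; rewrite {}/n; set r := q.+2; set b := r ^ r.*2; set n := b.*2 * r.
have b0 : 0 < b by rewrite expn_gt0.
have card_geq : b.*2`! ^ q <= #|asym_perms n k|.
  rewrite /n -(@prednK b.*2) ?double_gt0 //.
  exact: card_asym_perms_geq.
have fact_leq : n`! <= b.*2`! ^ r.+1.
  apply: leq_trans (fact_muln_leq _ _) _; rewrite expnS mulnC leq_mul2r.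
  apply/orP; right; have := expn_leq_fact_addn b b.
  rewrite addnn -[in b ^ _]/(r ^ r.*2) -expnM; apply: leq_trans.
  by apply: eq_leq; congr (_ ^ _); lia.
rewrite -[q.+3]/r.+1.
have [q_eq0|q0] := posnP q.
  by rewrite q_eq0 expn0 expn_gt0 (leq_trans _ card_geq) ?expn_gt0 ?fact_gt0.
apply: leq_trans (_ : (b.*2`! ^ q) ^ r.+1 <= _); last by rewrite leq_exp2r.
by rewrite expnAC leq_exp2r.
Qed.

Local Open Scope ring_scope.

Lemma ceil_pow_gt0 (R : realType) (eps : R) n :
  0 <= eps -> (0 < n)%N -> (0 < ceil_pow eps n)%N.
Proof.
by move=> eps0 n0; rewrite absz_gt0 gt_eqF // ceil_gt0 powR_gt0 // ltr0n.
Qed.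

Lemma log2_ratio_le1 (R : realType) (a b : nat) :
  (a <= b)%N -> log2 (a%:R : R) / log2 (b%:R : R) <= 1.
Proof.
move=> ab; have ln2 : 0 < ln 2 :> R by rewrite ln_gt0 // ltr1n.
(* For [b <= 1] the denominator is 0, and so is the quotient by the convention [invr0]. *)
have [b1|b1] := leqP b 1.
  suff lnb0 : ln b%:R = 0 :> R by rewrite /log2 lnb0 mul0r invr0 mulr0 ler01.
  by case: b b1 {ab} => [|[|//]] _; rewrite ?ln1 ?ln0.
have lnb : 0 < ln b%:R :> R by rewrite ln_gt0 // ltr1n.
rewrite ler_pdivrMr ?mul1r ?divr_gt0 // ler_pM2r ?invr_gt0 //.
have [->|a0] := posnP a; first by rewrite ln0 // ltW.
by rewrite ler_ln ?posrE ?ltr0n ?ler_nat //; lia.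
Qed.

Lemma log2_ratio_ge (R : realType) (a b p q : nat) :
  (1 < b)%N -> (0 < q)%N -> (b ^ p <= a ^ q)%N ->
  p%:R / q%:R <= log2 (a%:R : R) / log2 (b%:R : R).
Proof.
move=> b1 q0 hab; have ln2 : 0 < ln 2 :> R by rewrite ln_gt0 // ltr1n.
have lnb : 0 < ln b%:R :> R by rewrite ln_gt0 // ltr1n.
have b0 : (0 < b)%N by lia.
have a0 : (0 < a)%N.
  by move: hab; case: a => // ; rewrite exp0n // leqn0 expn_eq0; lia.
have -> : log2 (a%:R : R) / log2 (b%:R : R) = ln a%:R / ln b%:R.
  by rewrite /log2; field; rewrite !gt_eqF.
rewrite ler_pdivrMr ?ltr0n // mulrAC ler_pdivlMr //.
rewrite ![_ * q%:R]mulrC !mulr_natl -!lnXn ?ltr0n // -!natrX.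
by rewrite ler_ln ?posrE ?ltr0n ?expn_gt0 ?a0 ?b0 // ler_nat.
Qed.

Theorem theorem3 (R : realType) (eps : R) (heps0 : 0 <= eps) (heps1 : eps <= 1) :
  asym_capacity eps = 1%E.
Proof.
rewrite /asym_capacity limn_esup_lim; set u := (fun n => _).
(* Every tail supremum is already 1: each tail has terms arbitrarily close to 1. *)
suff -> : esups u = cst 1%E by rewrite lim_cst.
apply/funext => N; apply/eqP; rewrite eq_le; apply/andP; split.
  apply: ub_ereal_sup => _ [n _ <-]; rewrite lee_fin.
  by apply: log2_ratio_le1; rewrite -card_Sn max_card.
apply/lee_addgt0Pr => e e0.
(* The summand [N] puts [n] in the tail; the other gives [q > 3 / e], so
   [1 - q / (q + 3) = 3 / (q + 3) < e]. *)
pose q := (N + Num.bound (3 / e))%N.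
pose n := ((q.+2 ^ q.+2.*2).*2 * q.+2)%N.
have ltNn : (N < n)%N.
  by have : (0 < q.+2 ^ q.+2.*2)%N by [rewrite expn_gt0]; rewrite /n /q; nia.
have kgt0 : (0 < ceil_pow eps n)%N by apply: ceil_pow_gt0 => //; lia.
have hle := fact_leq_card_asym_perms q kgt0.
apply: (@le_trans _ _ (u n + e%:E)%E); last first.
  rewrite leeD2r //; apply: ereal_sup_ubound.
  by exists n => //=; exact: ltnW.
rewrite -EFinD lee_fin.
have fact_gt1 : (1 < n`!)%N.
  have n2 : (1 < n)%N.
    by have : (0 < q.+2 ^ q.+2.*2)%N by [rewrite expn_gt0]; rewrite /n; nia.
  by apply: leq_trans n2 _; apply: fact_geq.
have := log2_ratio_ge R fact_gt1 (ltn0Sn q.+2) hle.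
rewrite -lerBlDr; apply: le_trans.
have q_gt : 3 < e * q%:R.
  rewrite mulrC -ltr_pdivrMr //.
  apply: lt_le_trans (archi_boundP _) _; first by rewrite divr_ge0 // ltW.
  by rewrite ler_nat leq_addl.
rewrite ler_pdivlMr ?ltr0n //.
by rewrite -[q.+3]addn3 natrD; have : 0 <= q%:R :> R by []; nra.
Qed.
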